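(* Let $\mathbf{X}$ be a Polish space, regarded as a represented space via the Cauchy representation with respect to a compatible complete metric and a countable dense sequence. Then $\mathbf{X}$ is $'$-overt if and only if $\mathbf{X}$ is $K_\sigma$ (i.e. a countable union of compact subsets).
   Context: A represented space is a pair $(X,\delta_X)$ with $\delta_X:\subseteq\mathbb{N}^\mathbb{N}\to X$ a partial surjection; a map between represented spaces is continuous (computable) if it has a continuous (computable) realizer on names. $\mathcal{C}(\mathbf{X},\mathbf{Y})$ is the represented space of continuous maps (standard exponential representation). Sierpiński space is $\mathbb{S}=(\{\bot,\top\},\delta_\mathbb{S})$ with $\delta_\mathbb{S}(0^\mathbb{N})=\bot$ and $\delta_\mathbb{S}(p)=\top$ for $p\neq 0^\mathbb{N}$. Let $\lim:\subseteq\mathbb{N}^\mathbb{N}\to\mathbb{N}^\mathbb{N}$ be $\lim(p)(n)=\lim_{i\to\infty}p(\langle n,i\rangle)$ (defined when all these limits exist), $\langle\cdot,\cdot\rangle$ a standard pairing. For a represented space $\mathbf{Y}=(Y,\delta_Y)$, $\mathbf{Y}'=(Y,\delta_Y\circ\lim)$. So $\mathbb{S}'=(\{\bot,\top\},\delta_\mathbb{S}\circ\lim)$, and $\mathcal{O}'(\mathbf{X}):=\mathcal{C}(\mathbf{X},\mathbb{S}')$, whose elements are identified with subsets of $X$ (the preimage of $\top$). $\mathbf{X}$ is $'$-overt if the map $\operatorname{IsNonEmpty}:\mathcal{O}'(\mathbf{X})\to\mathbb{S}'$, $U\mapsto\top$ iff $U\neq\emptyset$, is computable; for a Polish space without a fixed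 computability structure this is understood relative to an oracle, i.e. the map is continuous. *)

(* Defs.v *)
From HB Require Import structures.
From mathcomp Require Import all_boot all_order all_algebra.
From mathcomp Require Import boolp classical_sets reals topology.
Set Implicit Arguments. Unset Strict Implicit. Unset Printing Implicit Defensive.
Import Order.TTheory GRing.Theory Num.Theory.
Local Open Scope classical_set_scope.
Local Open Scope ring_scope.

Definition baire := nat -> nat.

(* A representation of X is given as a relation [delta p x] = "p is a name of x"
   (i.e. delta_X(p) = x).  [rep_dom delta] is dom(delta). *)
Definition rep_dom (X : Type) (delta : baire -> X -> Prop) : set baire :=
  fun p => exists x, delta p x.

Definition agree (m : nat) (p q : baire) : Prop := forall i, (i < m)%N -> p i = q i.

Definition cont_on (D : set baire) (F : baire -> baire) : Prop :=
  forall p, D p -> forall n, exists m, forall q, D q -> agree m p q -> F q n = F p n.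

Definition rep_continuous (X Y : Type) (dX : baire -> X -> Prop)
    (dY : baire -> Y -> Prop) (f : X -> Y) : Prop :=
  exists F : baire -> baire, cont_on (rep_dom dX) F /\
    forall p x, dX p x -> dY (F p) (f x).

(* top = true, bot = false;  delta_S(0^N) = bot, delta_S(p) = top for p <> 0^N *)
Definition deltaS (p : baire) (b : bool) : Prop := b = true <-> exists n, p n <> 0%N.

(* standard (Cantor) pairing <n, i> *)
Definition cpair (n i : nat) : nat := (((n + i) * (n + i).+1)./2 + i)%N.

Definition is_lim (p r : baire) : Prop :=
  forall n, exists N, forall i, (N <= i)%N -> p (cpair n i) = r n.

Definition jump (Y : Type) (dY : baire -> Y -> Prop) (p : baire) (y : Y) : Prop :=
  exists r, is_lim p r /\ dY r y.

Definition deltaS' := jump deltaS.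

Definition prefix (q : baire) (m : nat) : seq nat := mkseq q m.

(* standard coding of continuous partial maps on Baire space:
   F_p(q)(n) = k  iff  for the least m with p(code(n, q|m)) <> 0 we have
   p(code(n, q|m)) = k + 1.  Here code is the (injective) standard
   enumeration [pickle] of nat * seq nat. *)
Definition code_val (p q : baire) (n k : nat) : Prop :=
  exists m, p (pickle (n, prefix q m)) = k.+1 /\
    forall m', (m' < m)%N -> p (pickle (n, prefix q m')) = 0%N.

Definition code_eval (p q r : baire) : Prop := forall n, code_val p q n (r n).

Definition deltaC (X Y : Type) (dX : baire -> X -> Prop) (dY : baire -> Y -> Prop)
    (p : baire) (f : X -> Y) : Prop :=
  forall q x, dX q x -> exists r, code_eval p q r /\ dY r (f x).

(* O'(X) = C(X, S'), elements identified with their characteristic maps X -> bool *)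
Definition deltaO' (X : Type) (dX : baire -> X -> Prop) := deltaC dX deltaS'.

Definition IsNonEmpty (X : Type) (U : X -> bool) : bool := `[< exists x, U x = true >].

(* X is '-overt (relative to an oracle): IsNonEmpty : O'(X) -> S' is continuous *)
Definition jump_overt (X : Type) (dX : baire -> X -> Prop) : Prop :=
  rep_continuous (deltaO' dX) deltaS' (@IsNonEmpty X).

Definition compatible_complete_metric (R : realType) (X : topologicalType)
    (d : X -> X -> R) : Prop :=
  [/\ (forall x y, d x y = 0 <-> x = y),
      (forall x y, d x y = d y x),
      (forall x y z, d x z <= d x y + d y z),
      (forall A : set X, open A <->
         (forall x, A x -> exists2 e : R, 0 < e & forall y, d x y < e -> A y)) &
      (forall u : nat -> X,
         (forall e : R, 0 < e -> exists N, forall m n, (N <= m)%N -> (N <= n)%N ->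
            d (u m) (u n) < e) ->
         exists x, forall e : R, 0 < e -> exists N, forall n, (N <= n)%N -> d (u n) x < e)].

Definition dense_seq (R : realType) (X : Type) (d : X -> X -> R) (a : nat -> X) : Prop :=
  forall x (e : R), 0 < e -> exists n, d x (a n) < e.

Definition cauchy_rep (R : realType) (X : Type) (d : X -> X -> R) (a : nat -> X)
    (p : baire) (x : X) : Prop :=
  forall n, d (a (p n)) x <= (2 ^+ n)^-1.

Definition K_sigma (X : topologicalType) : Prop :=
  exists K : nat -> set X, (forall n, compact (K n)) /\ \bigcup_n K n = setT.

(* Main.v *)
Require Import Defs.
From HB Require Import structures.
From mathcomp Require Import all_boot all_order all_algebra.
From mathcomp Require Import boolp classical_sets reals topology.
From mathcomp Require Import lra zify.
Import Order.TTheory GRing.Theory Num.Theory.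
Local Open Scope ring_scope.

(* Names bounded by a fixed sequence name a compact set, and every compact set
   is covered by such names; so X is K_sigma iff countably many bounds suffice.
   If they do, a Sigma^0_2 set U is nonempty iff for some bound b, row j and
   threshold N, some name below b keeps row j of its evaluation nonzero from N
   on. By compactness of the set of names below b this can be tested up to every
   M separately, so nonemptiness is again Sigma^0_2.
   If they do not, then the points without any covered ball form a nonempty
   kernel, each of whose balls contains an infinite uniformly separated sequence
   of kernel points. Iterating gives a Hurewicz scheme of balls, along which one
   assigns to z in Baire space, continuously, a closed set that is nonempty iff z
   has infinitely many nonzero entries. A realizer of IsNonEmpty would make this
   Pi^0_2-complete condition Sigma^0_2, which a diagonalisation refutes. *)

(** * Ultrafilters and finitely many alternatives *)

Section Ultrafilter.
Local Open Scope classical_set_scope.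
Context {T : Type} {F : set_system T} {UF : UltraFilter F}.

(** Used one coordinate at a time, this replaces extracting a diagonal subsequence. *)
Lemma ultra_pigeonhole (P : nat -> T -> Prop) (b : nat) :
  F [set t | exists2 v, (v <= b)%N & P v t] ->
  exists2 v, (v <= b)%N & F [set t | P v t].
Proof.
elim: b => [|b IH] Fb.
  exists 0%N => //; apply: filterS Fb => t [v]; by rewrite leqn0 => /eqP ->.
have [Fv|Fv] := in_ultra_setVsetC [set t | P b.+1 t] UF; first by exists b.+1.
have [|v vb Pv] := IH; last by exists v => //; lia.
apply: filterS (filterI Fb Fv) => t [[v vb Pv] nP]; exists v => //.
by move: vb; rewrite leq_eqVlt => /orP[/eqP e|//]; case: nP; rewrite /= -e.
Qed.

End Ultrafilter.

(** * Cauchy names, compactness and the kernel *)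

Section CauchyNames.
Local Open Scope classical_set_scope.
Context {R : realType} {X : topologicalType} {d : X -> X -> R} {a : nat -> X}.
Context (dP : compatible_complete_metric d).
Context (aP : dense_seq d a).

Local Notation eps n := ((2%:R ^+ n)^-1 : R).

Lemma eps_gt0 n : 0 < eps n.
Proof. by rewrite invr_gt0 exprn_gt0. Qed.

Lemma eps_double n : eps n.+1 + eps n.+1 = eps n.
Proof.
by rewrite exprS invfM; lra.
Qed.

Lemma eps_le m n : (m <= n)%N -> eps n <= eps m.
Proof.
move=> mn; rewrite lef_pV2 ?posrE ?exprn_gt0 //.
by rewrite ler_eXn2l // ltr1n.
Qed.

Lemma eps_small (e : R) : 0 < e -> exists n, eps n < e.
Proof.
move=> e0; exists (Num.bound e^-1).
rewrite -[e in _ < e]invrK ltf_pV2 ?posrE ?exprn_gt0 ?invr_gt0 //.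
exact: upper_nthrootP.
Qed.

Lemma dist_refl x : d x x = 0.
Proof. by case: dP => + _ _ _ _ => ->. Qed.

Lemma dist_sym x y : d x y = d y x.
Proof. by case: dP. Qed.

Lemma dist_triangle y x z : d x z <= d x y + d y z.
Proof. by case: dP. Qed.

Lemma dist_nbhsP (y : X) (A : set X) :
  nbhs y A <-> exists2 e : R, 0 < e & forall x, d y x < e -> A x.
Proof.
have opP : forall B : set X, open B <-> (forall x, B x -> exists2 e : R, 0 < e &
  forall z, d x z < e -> B z) by case: dP.
split=> [|[e e0 eA]].
  rewrite nbhsE => -[B [oB By] BA]; have [e e0 eB] := (opP B).1 oB y By.
  by exists e => // x /eB /BA.
rewrite nbhsE; exists [set x | d y x < e]; last by move=> x /eA.
split; last by rewrite /= dist_refl.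
apply/opP => x /= yx; exists (e - d y x) => [|z xz]; first lra.
have := dist_triangle x y z; lra.
Qed.

(* Being a name of some point is thus a closed condition on [q]. *)
Lemma nameP (q : baire) :
  (exists x, cauchy_rep d a q x) <->
  (forall i j, d (a (q i)) (a (q j)) <= eps i + eps j).
Proof.
split=> [[x qx] i j|qC].
  have := dist_triangle x (a (q i)) (a (q j)).
  have := qx i; have := qx j; rewrite (dist_sym (a (q j))); lra.
have [x xP] : exists x, forall e : R, 0 < e ->
    exists N, forall n, (N <= n)%N -> d (a (q n)) x < e.
  case: dP => _ _ _ _; apply=> e e0; have [N Ne] := eps_small e e0.
  exists N.+1 => m n mN nN; have := qC m n; have := eps_double N.
  have := eps_le N.+1 m mN; have := eps_le N.+1 n nN; lra.
exists x => n; rewrite leNgt; apply/negP => lt_x.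
(* Half of the supposed excess over [eps n] is allotted to the tail and half to the error
   [eps M]. *)
have [|N NP] := xP ((d (a (q n)) x - eps n) / 2); first lra.
have [M ME] := eps_small ((d (a (q n)) x - eps n) / 2) ltac:(lra).
have := NP (maxn N M) (leq_maxl _ _); have := qC n (maxn N M).
have := dist_triangle (a (q (maxn N M))) (a (q n)) x.
have := eps_le M (maxn N M) (leq_maxr _ _); lra.
Qed.

Definition bounded_by (b : baire) : set X :=
  [set x | exists2 q, cauchy_rep d a q x & forall i, (q i <= b i)%N].

(** Inclusion instead of equality makes the notion pass to subsets. *)
Definition sbounded (A : set X) : Prop :=
  exists b : nat -> baire, A `<=` \bigcup_n bounded_by (b n).

(** The ultrafilter fixes each entry of a name; the entries are consistent because any two sets of
    the filter meet. *)
Lemma compact_bounded_by b : compact (bounded_by b).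
Proof.
rewrite compact_ultra => F UF Fb.
have /choice[q qP] i : exists v,
    (v <= b i)%N /\ F [set x | d (a v) x <= eps i].
  have [|v vb Fv] := ultra_pigeonhole (fun v x => d (a v) x <= eps i) (b i).
    by apply: filterS Fb => x [q qx qb]; exists (q i); [exact: qb|exact: qx].
  by exists v.
have [y qy] : exists y, cauchy_rep d a q y.
  apply/nameP => i j.
  have [x [/= xi xj]] := filter_ex (filterI (qP i).2 (qP j).2).
  have := dist_triangle x (a (q i)) (a (q j)).
  rewrite (dist_sym x); lra.
exists y; split; first by exists q => // i; have [] := qP i.
move=> A /dist_nbhsP[e e0 eA]; have [n ne] := eps_small e e0.
apply: filterS (qP n.+1).2 => x /= xn; apply: eA.
have := dist_triangle (a (q n.+1)) y x; have := qy n.+1.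
have := eps_double n; rewrite (dist_sym y (a _)); lra.
Qed.

(** [b n] dominates indices of dense points near a finite net; the net and the approximation each
    cost [eps n.+1]. *)
Lemma totally_bounded_bounded_by (A : set X) :
  (forall e : R, 0 < e ->
    exists s : seq X, forall x, A x -> exists2 y, List.In y s & d x y < e) ->
  exists b, A `<=` bounded_by b.
Proof.
move=> Atb.
have /choice[b bP] n : exists b, forall x, A x ->
    exists2 v, (v <= b)%N & d (a v) x <= eps n.
  have [s sP] := Atb _ (eps_gt0 n.+1).
  have [b bP] : exists b, forall y, List.In y s ->
      exists2 v, (v <= b)%N & d y (a v) < eps n.+1.
    elim: {sP} s => [|z s [b bP]]; first by exists 0%N.
    have [v zv] := aP z _ (eps_gt0 n.+1).
    exists (maxn b v) => y [<-|/bP [w wb yw]].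
      by exists v => //; rewrite leq_maxr.
    by exists w => //; rewrite leq_max wb.
  exists b => x /sP[y /bP[v vb yv] xy]; exists v => //.
  have := dist_triangle y (a v) x; rewrite (dist_sym (a v) y) (dist_sym y x).
  have := eps_double n; lra.
exists b => x Ax.
have /choice[q qP] n : exists v, (v <= b n)%N /\ d (a v) x <= eps n.
  by have [v vb vx] := bP n x Ax; exists v.
by exists q => n; have [] := qP n.
Qed.

(** Without a finite net, the sets of points of [K] that are [e]-far from finite lists generate a
    proper filter, and a cluster point of it is refuted by the list consisting of itself. *)
Lemma compact_totally_bounded (K : set X) : compact K ->
  forall e : R, 0 < e ->
    exists s : seq X, forall x, K x -> exists2 y, List.In y s & d x y < e.
Proof.
move=> cK e e0; apply: contrapT => ns.
pose B (s : seq X) := [set x | K x /\ forall y, List.In y s -> e <= d x y].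
have BB s s' : B (s ++ s') = B s `&` B s'.
  apply/seteqP; split=> [x [Kx xs]|x [[Kx xs] [_ xs']]].
    by split; split=> // y ys; apply: xs; apply/List.in_or_app; [left|right].
  by split=> // y ys; case: (List.in_app_or _ _ _ ys); [exact: xs|exact: xs'].
pose F : set_system X := [set A | exists s, B s `<=` A].
have FF : ProperFilter F.
  split; [|split].
  - move=> -[s sB]; apply: ns; exists s => x Kx; apply: contrapT => nx.
    apply: (sB x); split=> // y ys; rewrite leNgt; apply/negP => xy.
    by apply: nx; exists y.
  - by exists [::].
  - move=> P Q [s sP] [s' s'Q]; exists (s ++ s'); rewrite BB => x [xs xs'].
    by split; [exact: sP|exact: s'Q].
  - by move=> P Q PQ [s sP]; exists s => x /sP /PQ.
have [|x [Kx clx]] := cK F FF; first by exists [::] => x [].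
have [] := clx (B [:: x]) [set y | d x y < e].
- by exists [:: x].
- by apply/dist_nbhsP; exists e.
- move=> y [[_ /(_ x (or_introl erefl))] /=]; rewrite dist_sym; lra.
Qed.

Lemma K_sigmaP : K_sigma X <-> sbounded setT.
Proof.
split=> [[K [cK KT]]|[b bT]].
  have /choice[b bP] n : exists b, K n `<=` bounded_by b.
    apply: totally_bounded_bounded_by.
    exact: compact_totally_bounded.
  exists b => x; rewrite -KT => -[n _ Kx]; exists n => //; exact: bP.
exists (fun n => bounded_by (b n)); split.
  by move=> n; exact: compact_bounded_by.
by apply/seteqP; split=> // x _; exact: bT.
Qed.

Lemma sbounded_subset (A B : set X) : A `<=` B -> sbounded B -> sbounded A.
Proof. by move=> AB [b bB]; exists b => x /AB /bB. Qed.

Lemma sbounded_bounded_by b : sbounded (bounded_by b).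
Proof. by exists (fun=> b) => x bx; exists 0%N. Qed.

Lemma sbounded_bigcup (I : countType) (A : I -> set X) :
  (forall i, sbounded (A i)) -> sbounded (\bigcup_i A i).
Proof.
move=> sA; have [b bP] := choice sA.
(* Indices that code no pair get the zero bound, which only enlarges the union. *)
exists (fun n => if unpickle n is Some (i, k) then b i k else fun=> 0%N).
move=> x [i _ /(bP i)[k _ xk]]; exists (pickle (i, k)) => //.
by rewrite pickleK.
Qed.

Definition kernel : set X :=
  [set x | forall e : R, 0 < e -> ~ sbounded [set y | d x y < e]].

(** A Lindelöf argument with the countably many balls of radius [eps k] around dense points. *)
Lemma sbounded_compl_kernel : sbounded (~` kernel).
Proof.
pose B (i : nat * nat) := [set y | d (a i.1) y < eps i.2].
apply: (@sbounded_subset _ (\bigcup_(i in [set i | sbounded (B i)]) B i)).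
  move=> x /existsNP[e /not_implyP[e0 /contrapT sb]].
  have [k ke] := eps_small e e0; have [n xn] := aP x _ (eps_gt0 k.+1).
  have xB y : B (n, k.+1) y -> d x y < e.
    rewrite /B /= => yB; have := dist_triangle (a n) x y.
    have := eps_double k; lra.
  exists (n, k.+1); last by rewrite /B /= dist_sym.
  exact: sbounded_subset sb.
rewrite bigcup_mkcond; apply: sbounded_bigcup => i.
case: ifPn => [/set_mem //|_]; by exists (fun=> fun=> 0%N).
Qed.

Lemma kernel_nonempty : ~ sbounded setT -> exists x, kernel x.
Proof.
move=> nT; apply: contrapT => nk; apply: nT.
apply: sbounded_subset sbounded_compl_kernel => x _ kx; apply: nk.
by exists x.
Qed.

(* The part of the ball inside the kernel is not totally bounded, since the
   rest of the ball is already covered. *)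
Lemma kernel_separated_sequence x (e : R) : kernel x -> 0 < e ->
  exists (r : R) (u : nat -> X), 0 < r /\ forall i,
    [/\ kernel (u i), d x (u i) < e & forall j, i != j -> r <= d (u i) (u j)].
Proof.
move=> kx e0; pose A := [set y | kernel y /\ d x y < e].
have [r r0 rP] : exists2 r : R, 0 < r & forall s : seq X,
    exists y, A y /\ forall z, List.In z s -> r <= d y z.
  apply: contrapT => nr; apply: (kx e e0).
  have [b bA] : exists b, A `<=` bounded_by b.
    apply: totally_bounded_bounded_by => r r0; apply: contrapT => ns.
    apply: nr; exists r => // s; apply: contrapT => ny; apply: ns; exists s.
    move=> y Ay; apply: contrapT => nz; apply: ny; exists y; split=> // z zs.
    by rewrite leNgt; apply/negP => yz; apply: nz; exists z.
  pose C (c : bool) := if c then bounded_by b else ~` kernel.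
  apply: (@sbounded_subset _ (\bigcup_c C c)) => [y xy|].
    have [ky|nky] := pselect (kernel y); last by exists false.
    by exists true => //; apply: bA.
  apply: sbounded_bigcup => -[]; first exact: sbounded_bounded_by.
  exact: sbounded_compl_kernel.
(* Greedy choice: [L n] lists the first [n] points, and [g] supplies one that is [r]-far from all of
   them. *)
have [g gP] := choice rP; pose L := fix L n := if n is m.+1 then g (L m) :: L m else [::].
have LP i j : (i < j)%N -> List.In (g (L i)) (L j).
  elim: j => // j IH; rewrite ltnS leq_eqVlt => /orP[/eqP ->|/IH]; first by left.
  by right.
exists r, (fun i => g (L i)); split=> // i; split; try by case: (gP (L i)) => -[].
move=> j; rewrite neq_ltn => /orP[] /LP ij; last by case: (gP (L i)) => _ /(_ _ ij).
by rewrite dist_sym; case: (gP (L j)) => _ /(_ _ ij).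
Qed.

End CauchyNames.

(** * Pairing, prefixes and coded partial functions *)

Section Coding.
Set Implicit Arguments. Unset Strict Implicit.
Local Open Scope nat_scope.

Lemma cpair_inj n i n' i' : cpair n i = cpair n' i' -> n = n' /\ i = i'.
Proof.
pose tri k := (k * k.+1)./2.
have triS k : tri k.+1 = tri k + k.+1.
  rewrite /tri (_ : k.+1 * k.+2 = k * k.+1 + k.+1 * 2); last lia.
  by lia.
have tri_lt k k' : k < k' -> tri k + k < tri k'.
  elim: k' => // k' IH; rewrite ltnS leq_eqVlt triS => /orP[/eqP ->|/IH]; lia.
rewrite /cpair -/(tri (n + i)) -/(tri (n' + i')) => eq_tri.
have : n + i = n' + i'.
  by have [/tri_lt|/tri_lt|//] := ltngtP (n + i) (n' + i'); lia.
by move=> e; move: eq_tri; rewrite e; lia.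
Qed.

Lemma cpair_ge n i : i <= cpair n i.
Proof. by rewrite /cpair leq_addl. Qed.

Lemma agree_le m m' p q : m <= m' -> agree m' p q -> agree m p q.
Proof. by move=> mm' pq i im; apply: pq; lia. Qed.

Lemma agree_sym m p q : agree m p q -> agree m q p.
Proof. by move=> pq i im; rewrite pq. Qed.

Lemma eq_prefix m p q : agree m p q -> Defs.prefix p m = Defs.prefix q m.
Proof.
move=> pq; apply: (@eq_from_nth _ 0); rewrite ?size_mkseq // => i im.
by rewrite !nth_mkseq // pq.
Qed.

Lemma prefix_agree m p q : Defs.prefix p m = Defs.prefix q m -> agree m p q.
Proof.
move=> pq i im; rewrite -(nth_mkseq 0 p im) -(nth_mkseq 0 q im).
by rewrite -/(Defs.prefix p m) pq.
Qed.

Lemma uniform_bound (P : nat -> nat -> Prop) n :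
  (forall i m m', P i m -> m <= m' -> P i m') -> (forall i, i < n -> exists m, P i m) ->
  exists m, forall i, i < n -> P i m.
Proof.
move=> Pmono; elim: n => [|n IH] Pn; first by exists 0.
have [|m mP] := IH; first by move=> i im; apply: Pn; lia.
have [m' m'P] := Pn n (ltnSn n); exists (maxn m m') => i.
rewrite ltnS leq_eqVlt => /orP[/eqP ->|/mP Pi].
  by apply: Pmono m'P _; rewrite leq_maxr.
by apply: Pmono Pi _; rewrite leq_maxl.
Qed.

Lemma code_val_inj p q n k k' : code_val p q n k -> code_val p q n k' -> k = k'.
Proof.
move=> [m [mk m0]] [m' [mk' m0']].
have [/m0'|/m0|e] := ltngtP m m'; [by rewrite mk|by rewrite mk'|].
by move: mk; rewrite e mk' => -[].
Qed.

(** The search up to the successful [m] reads finitely many entries of [p] and of [q]. *)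
Lemma code_val_local p q n k : code_val p q n k ->
  exists M, forall p' q', agree M p p' -> agree M q q' -> code_val p' q' n k.
Proof.
move=> [m [mk m0]].
have [|i _|M MP] := @uniform_bound
  (fun i M => pickle (n, Defs.prefix q i) < M) m.+1; [by move=> *; lia|by eexists|].
exists (maxn m M) => p' q' pp qq.
have E i : i <= m -> p' (pickle (n, Defs.prefix q' i)) = p (pickle (n, Defs.prefix q i)).
  move=> im; rewrite -(@eq_prefix i q q'); last by apply: agree_le qq; lia.
  by apply/esym/pp; have := MP i im; lia.
exists m; rewrite E //; split=> // i im; rewrite E ?m0 //; lia.
Qed.

End Coding.

(** * From countably many bounds to overtness *)

Section SigmaCompactOvert.
Set Implicit Arguments. Unset Strict Implicit.
Local Open Scope classical_set_scope.
Context {R : realType} {X : topologicalType} {d : X -> X -> R} {a : nat -> X}.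
Context (dP : compatible_complete_metric d).
Context (aP : dense_seq d a).

Let name (b q : baire) := (exists x, cauchy_rep d a q x) /\ forall i, (q i <= b i)%N.

(** Sequential compactness of the names below [b]: an ultrafilter refining the eventual filter
    selects each entry. *)
Lemma cluster_name b (q : nat -> baire) : (forall m, name b (q m)) ->
  exists2 q0, name b q0 &
    forall k m0, exists2 m, (m0 <= m)%N & agree k q0 (q m).
Proof.
move=> qP; have [U [UU oU]] := ultraFilterLemma eventually_filter.
have /choice[q0 q0P] i : exists v, (v <= b i)%N /\ U [set m | q m i = v].
  have [|v vb Uv] := @ultra_pigeonhole _ U UU (fun v m => q m i = v) (b i).
    by apply: filterS filterT => m _; exists (q m i) => //; case: (qP m).
  by exists v.
exists q0.
  split=> [|i]; last by have [] := q0P i.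
  apply/(nameP dP) => i j.
  have [m [/= <- <-]] := filter_ex (filterI (q0P i).2 (q0P j).2).
  by have [/(nameP dP)] := qP m.
move=> k m0.
have Uk : U [set m | agree k q0 (q m)].
  elim: k => [|k IH]; first by apply: filterS filterT => m _ i.
  apply: filterS (filterI IH (q0P k).2) => m [/= km mk] i.
  by rewrite ltnS leq_eqVlt => /orP[/eqP ->|/km].
have Um : U [set m | (m0 <= m)%N] by apply: oU; exists m0.
by have [m [mk mm]] := filter_ex (filterI Uk Um); exists m.
Qed.

Lemma cluster_nonzero b (p : baire) (ps qs : nat -> baire) (G : nat -> nat -> Prop) :
  rep_dom (deltaO' (cauchy_rep d a)) p ->
  (forall m, agree m p (ps m)) -> (forall m, name b (qs m)) ->
  (forall m c, G m c -> exists k, code_val (ps m) (qs m) c k.+1) ->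
  exists2 q, name b q & forall c, (exists m0, forall m, (m0 <= m)%N -> G m c) ->
    exists k, code_val p q c k.+1.
Proof.
move=> [U pU] pps nqs nz; have [q nq clq] := cluster_name nqs.
exists q => // c [m0 Gc]; have [x qx] := nq.1.
have [r [/(_ c) pr _]] := pU q x qx.
have [M MP] := code_val_local pr.
have [m Mm qm] := clq M (maxn m0 M).
have [|k nzk] := nz m c; first by apply: Gc; lia.
have := MP (ps m) (qs m) (agree_le _ (pps m)) qm.
move=> /(_ ltac:(lia)) /code_val_inj /(_ nzk) rk.
by exists k; rewrite -rk.
Qed.

(** The stage [M] of the condition that some name below [b] keeps row [j] nonzero from [N] on. *)
Let witness (b : baire) (j N M : nat) (p : baire) := exists2 q, name b q &
  forall i, (N <= i <= M)%N -> exists k, code_val p q (cpair j i) k.+1.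

(** Truth persists by finite use; falsity persists because witnesses for [p'] tending to [p] would
    cluster at a witness for [p]. *)
Lemma witness_locally_constant b j N M p :
  rep_dom (deltaO' (cauchy_rep d a)) p ->
  exists m, forall p', agree m p p' -> (witness b j N M p' <-> witness b j N M p).
Proof.
move=> pD; have [[q nq qP]|nw] := pselect (witness b j N M p).
  have [m mP] : exists m, forall i, (i < M.+1)%N -> forall p', (N <= i)%N ->
      agree m p p' -> exists k, code_val p' q (cpair j i) k.+1.
    apply: uniform_bound => [i m m' H mm' p' Ni pp|i iM].
      by apply: H => //; apply: agree_le pp.
    have [Ni|Ni] := leqP N i; last by exists 0%N => p'; lia.
    have [|k /code_val_local[m mP]] := qP i; first lia.
    by exists m => p' _ pp; exists k; apply: mP.
  exists m => p' pp; split=> _; first by exists q.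
  by exists q => // i iNM; apply: mP => //; lia.
apply: contrapT => nm; apply: (nw).
have /choice[ps psP] m : exists p', agree m p p' /\ witness b j N M p'.
  apply: contrapT => np; apply: nm; exists m => p' pp.
  by split=> [wp'|/nw//]; case: np; exists p'.
have /choice[qs qsP] m : exists q, name b q /\ forall i, (N <= i <= M)%N ->
    exists k, code_val (ps m) q (cpair j i) k.+1.
  by have [_ [q nq qP]] := psP m; exists q.
have [||m c Gc|q nq qP] := @cluster_nonzero b p ps qs
  (fun m c => exists2 i, (N <= i <= M)%N & c = cpair j i) pD.
- by move=> m; have [] := psP m.
- by move=> m; have [] := qsP m.
- by move: Gc => [i iNM ->]; have [_] := qsP m; apply.
- by exists q => // i iNM; apply: qP; exists 0%N => m _; exists i.
Qed.

Lemma sbounded_jump_overt : sbounded (d := d) (a := a) setT ->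
  jump_overt (cauchy_rep d a).
Proof.
move=> [b bT].
(* Each row tests one triple [(n, j, N)] and each column one stage [M]; all other entries are 0. *)
pose F (p : baire) (c : nat) : nat := `[< exists n j N M,
  c = cpair (pickle (n, j, N)) M /\ witness (b n) j N M p >].
have FP p n j N M : F p (cpair (pickle (n, j, N)) M) = `[< witness (b n) j N M p >].
  congr nat_of_bool; apply/asbool_equiv_eq; split=> [|w]; last first.
    by exists n, j, N, M.
  move=> [n' [j' [N' [M' [/cpair_inj[]]]]]].
  by move=> /(pcan_inj pickleK) [-> -> ->] ->.
exists F; split=> [p pD c|p U pU].
  case: (pselect (exists n j N M : nat, c = cpair (pickle (n, j, N)) M)) => [[n [j [N [M cE]]]]|nc]; last first.
    exists 0%N => q _ _; congr nat_of_bool; apply/asbool_equiv_eq.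
    by split=> -[n [j [N [M [cE _]]]]]; case: nc; exists n, j, N, M.
  rewrite cE; have [m mP] := witness_locally_constant (b n) j N M pD.
  by exists m => q _ /mP wE; rewrite !FP; congr nat_of_bool; apply/asbool_equiv_eq.
(* Rows can only drop from 1 to 0, so they converge. *)
have Fmono e M M' : (M <= M')%N -> F p (cpair e M') = 1%N -> F p (cpair e M) = 1%N.
  move=> MM'; rewrite {1}/F; case: asboolP => // -[n [j [N [M'' [/cpair_inj[-> <-]]]]]].
  move=> [q nq qP] _; rewrite FP asboolT //; exists q => // i iM; apply: qP; lia.
exists (fun e => `[< forall M, F p (cpair e M) = 1%N >] : nat); split.
  move=> e; case: asboolP => [F1|]; first by exists 0%N => i _.
  move=> /existsNP[N FN]; exists N => i Ni.
  have := Fmono e N i Ni; rewrite {1 3}/F.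
  by case: asboolP => // _ /(_ erefl) /FN.
have pD : rep_dom (deltaO' (cauchy_rep d a)) p by exists U.
rewrite /deltaS /IsNonEmpty; split=> [/asboolP[x Ux]|[e]].
  have [n _ [q qx qb]] := bT x I.
  have [r [pr [s [rs [/(_ Ux)[j sj] _]]]]] := pU q x qx.
  have [N NP] := rs j; exists (pickle (n, j, N)).
  rewrite asboolT // => M; rewrite FP asboolT //.
  exists q => [|i /andP[Ni _]]; first by split=> //; exists x.
  have := pr (cpair j i); rewrite (NP i Ni); case: (s j) sj => // k _ kv.
  by exists k.
case: asboolP => // F1 _.
(* A row containing a 1 belongs to some triple. *)
have [n [j [N [M [eE _]]]]] : exists n j N M, cpair e 0 =
    cpair (pickle (n, j, N)) M /\ witness (b n) j N M p.
  by have := F1 0%N; rewrite /F; case: asboolP.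
have {eE} [eE _] := cpair_inj eE; rewrite {}eE in F1.
have /choice[qs qsP] m : exists q, name (b n) q /\ forall i, (N <= i <= m)%N ->
    exists k, code_val p q (cpair j i) k.+1.
  by have := F1 m; rewrite FP; case: asboolP => // -[q nq qP] _; exists q.
(* With [ps] constant and growing windows, the cluster name serves all columns from [N] on. *)
have [||m c Gc|q [[x qx] _] qP] := @cluster_nonzero (b n) p (fun=> p) qs
  (fun m c => exists2 i, (N <= i <= m)%N & c = cpair j i) pD.
- by [].
- by move=> m; have [] := qsP m.
- by move: Gc => [i iNM ->]; have [_] := qsP m; apply.
apply/asboolP; exists x; have [r [pr [s [rs [_ Ux]]]]] := pU q x qx; apply: Ux; exists j.
(* Column [maxn N N'] is past both the threshold and the point where row [j] stabilises, so [s j] is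
   nonzero. *)
have [N' N'P] := rs j; rewrite -(N'P (maxn N N')) ?leq_maxr //.
have [|k kv] := qP (cpair j (maxn N N')).
  by exists (maxn N N') => m Nm; exists (maxn N N') => //; lia.
by rewrite (code_val_inj (pr _) kv).
Qed.

End SigmaCompactOvert.

(** * Infinite support is not a Sigma^0_2 condition *)

Section Diagonalisation.
Set Implicit Arguments. Unset Strict Implicit.
Local Open Scope nat_scope.

Definition inf_support (z : baire) := forall m, exists2 j, m <= j & z j <> 0.

(* Baire category in disguise: [z] is built from finite blocks, the block at
   stage [t] ends with a nonzero entry and forces one more zero in row
   [row t] of [G z], where each row comes up infinitely often. *)
Lemma inf_support_not_sigma2 (G : baire -> baire) :
  (forall z n, exists m, forall z', agree m z z' -> G z' n = G z n) ->
  ~ forall z, deltaS' (G z) `[< inf_support z >].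
Proof.
move=> Gcont GP.
have /choice[row rowP] t : exists m, forall n k, t = cpair n k -> m = n.
  have [[n [k ->]]|nt] := pselect (exists n k, t = cpair n k).
    by exists n => n' k' /cpair_inj[].
  by exists 0 => n k tE; case: nt; exists n, k.
pose ext (s : seq nat) (z : baire) := forall i, i < size s -> z i = nth 0 s i.
have step (ts : nat * seq nat) : exists s' : seq nat,
    [/\ ext ts.2 (nth 0 s'),
        exists2 j, size ts.2 <= j < size s' & nth 0 s' j <> 0 &
        forall z, ext s' z -> exists2 i, ts.1 <= i & G z (cpair (row ts.1) i) = 0].
  case: ts => t s /=.
  (* [nth 0 s] has finite support, so row [row t] of [G] tends to 0 there. *)
  have [r [Gr [_ rP]]] := GP (nth 0 s).
  have [N NP] := Gr (row t).
  have r0 : r (row t) = 0.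
    apply: contrapT => rt.
    have /asboolP/(_ (size s))[j sj] := rP (ex_intro (fun n => r n <> 0) _ rt).
    by rewrite nth_default.
  have [m mP] := Gcont (nth 0 s) (cpair (row t) (maxn N t)).
  (* The block keeps all of [s] and the entries that fix the zero; the final 1 feeds the support. *)
  pose k := maxn m (size s).
  exists (rcons (mkseq (nth 0 s) k) 1).
  have sz : size (rcons (mkseq (nth 0 s) k) 1) = k.+1 by rewrite size_rcons size_mkseq.
  have nthk i : i < k -> nth 0 (rcons (mkseq (nth 0 s) k) 1) i = nth 0 s i.
    by move=> ik; rewrite nth_rcons size_mkseq ik nth_mkseq.
  split=> [i si||z zP].
  - by rewrite nthk //; lia.
  - by exists k; [lia|rewrite nth_rcons size_mkseq ltnn eqxx].
  - exists (maxn N t); first exact: leq_maxr.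
    rewrite mP => [|i im]; first by rewrite NP ?leq_maxl.
    by rewrite zP ?nthk //; lia.
have [nxt nxtP] := choice step.
pose S := fix S t := if t is t'.+1 then nxt (t', S t') else [::].
have Sext t : ext (S t) (nth 0 (S t.+1)) by case: (nxtP (t, S t)).
have Sjump t : exists2 j, size (S t) <= j < size (S t.+1) & nth 0 (S t.+1) j <> 0.
  by case: (nxtP (t, S t)).
have Ssize t : t <= size (S t).
  by elim: t => // t IH; have [j] := Sjump t; lia.
have Smono t k i : i < size (S t) -> i < size (S (t + k)) /\ nth 0 (S (t + k)) i = nth 0 (S t) i.
  move=> it; elim: k => [|k [ik <-]]; first by rewrite addn0.
  rewrite addnS; split; last exact: Sext.
  by have [j] := Sjump (t + k); lia.
pose z i := nth 0 (S i.+1) i.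
have zS t : ext (S t) z.
  move=> i it; rewrite /z; have [ti|ti] := leqP t i.+1.
    by rewrite -(subnKC ti); case: (Smono t (i.+1 - t) i it).
  rewrite -(subnKC (ltnW ti)); case: (Smono i.+1 (t - i.+1) i) => //.
have zinf : inf_support z.
  move=> m; have [j mj j0] := Sjump m; exists j; first by have := Ssize m; lia.
  by rewrite (zS m.+1) //; lia.
have [r [Gr [/(_ (asboolT zinf))[n rn] _]]] := GP z.
(* Stage [cpair n N] planted a zero of row [n] in a column at least [N], where the row already
   equals [r n]. *)
have [N NP] := Gr n; have [_ _ Snxt] := nxtP (cpair n N, S (cpair n N)).
have [i /= ti] := Snxt z (zS (cpair n N).+1).
by rewrite (rowP _ n N erefl) NP //; apply: leq_trans ti; exact: cpair_ge.
Qed.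

End Diagonalisation.

(** * A Hurewicz scheme of closed balls and its relation *)

Section HurewiczScheme.
Set Implicit Arguments. Unset Strict Implicit.
Local Open Scope classical_set_scope.
Context {R : realType} {X : topologicalType} {d : X -> X -> R} {a : nat -> X}.
Context (dP : compatible_complete_metric d).
Context (aP : dense_seq d a).

Local Notation eps n := ((2%:R ^+ n)^-1 : R).
Local Notation kernel := (kernel (d := d) (a := a)).

Let good (s : X * R) := kernel s.1 /\ 0 < s.2.
Let cball (s : X * R) := [set y | d s.1 y <= s.2].

Lemma separated_children (s : X * R) : good s ->
  exists (c : nat -> X * R) (r : R), 0 < r /\ forall k,
    [/\ good (c k), (c k).2 <= s.2 / 2, cball (c k) `<=` cball s &
        forall k' y y', k != k' -> cball (c k) y -> cball (c k') y' -> r <= d y y'].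
Proof.
move=> [ks s0].
have [|r [u [r0 uP]]] := kernel_separated_sequence dP aP s.1 (s.2 / 2) ks; first lra.
(* [r / 4] leaves distinct children [r / 2] apart; [s.2 / 2] keeps them inside the parent. *)
pose rho := Num.min (r / 4) (s.2 / 2).
have rho_r : rho <= r / 4 by rewrite ge_min lexx.
have rho_s : rho <= s.2 / 2 by rewrite ge_min lexx orbT.
exists (fun k => (u k, rho)), (r / 2); split=> [|k]; first lra.
have [kk uk sep] := uP k; split=> //=.
- by split=> //=; rewrite lt_min; apply/andP; split; lra.
- move=> y; rewrite /cball /= => ky.
  have := dist_triangle dP (u k) s.1 y; lra.
- move=> k' y y' /sep; rewrite /cball /= => ru ky ky'.
  have := dist_triangle dP y (u k) (u k').
  have := dist_triangle dP y' y (u k').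
  rewrite (dist_sym dP y' (u k')); lra.
Qed.

(* A zero in [z] moves on to the next child of the current ball, a nonzero
   entry selects that child: so [z] has infinite support iff the scheme
   descends forever. *)
Lemma closed_graph_relation x0 : kernel x0 -> exists T : baire -> set X,
  (forall z, (exists y, T z y) <-> inf_support z) /\
  (forall z q y, cauchy_rep d a q y ->
    (forall m, exists z' q' y',
      [/\ agree m z z', agree m q q', cauchy_rep d a q' y' & T z' y']) -> T z y).
Proof.
move=> kx0.
have /choice[child childP] s : exists c : nat -> X * R, good s ->
  exists2 r : R, 0 < r & forall k,
    [/\ good (c k), (c k).2 <= s.2 / 2, cball (c k) `<=` cball s &
        forall k' y y', k != k' -> cball (c k) y -> cball (c k') y' -> r <= d y y'].
  have [/separated_children[c [r [r0 cP]]]|ns] := pselect (good s).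
    by exists c => _; exists r.
  by exists (fun=> s).
(* The state is the current ball and the number of zeros read since it was entered; radius 1 starts
   the induction in [small]. *)
pose st (z : baire) := fix st m : (X * R) * nat :=
  if m is m'.+1 then
    if z m' == 0%N then ((st m').1, (st m').2.+1) else (child (st m').1 (st m').2, 0%N)
  else ((x0, 1), 0%N).
have st_good z m : good (st z m).1.
  elim: m => [|m IH] /=; first by split.
  by case: ifP => // _; have [r _ /(_ (st z m).2)[]] := childP _ IH.
have st_step z m : cball (st z m.+1).1 `<=` cball (st z m).1 /\
    (st z m.+1).1.2 <= (st z m).1.2.
  rewrite /=; case: ifP => _ /=; first by split.
  have [r _ /(_ (st z m).2)[_ le2 sub _]] := childP _ (st_good z m).
  by split=> //; have [_] := st_good z m; lra.
have st_mono z m m' : (m <= m')%N -> cball (st z m').1 `<=` cball (st z m).1 /\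
    (st z m').1.2 <= (st z m).1.2.
  move=> /subnKC <-; elim: (m' - m)%N => [|k [IH1 IH2]]; first by rewrite addn0; split.
  rewrite addnS; have [s1 s2] := st_step z (m + k)%N.
  by split=> [y /s1/IH1//|]; lra.
have st_agree z z' m : agree m z z' -> st z m = st z' m.
  elim: m => //= m IH zz; rewrite zz // IH //; exact: agree_le zz.
have st_idle z m t : (forall j, (m <= j < m + t)%N -> z j = 0%N) ->
    st z (m + t)%N = ((st z m).1, ((st z m).2 + t)%N).
  elim: t => [|t IH] z0; first by rewrite !addn0; case: (st z m).
  by rewrite addnS /= z0 ?IH ?addnS //=; [move=> j jm; apply: z0|]; lia.
exists (fun z y => inf_support z /\ forall m, cball (st z m).1 y); split.
  move=> z; split=> [[y []//]|zinf].
  have small n : exists m, (st z m).1.2 <= eps n.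
    elim: n => [|n [m mn]]; first by exists 0%N; rewrite expr0 invr1.
    have [j mj /eqP/negPf zj] := zinf m; exists j.+1; rewrite /= zj.
    have [r _ /(_ (st z j).2)[_ le2 _ _]] := childP _ (st_good z j).
    have := (st_mono z m j mj).2; have := eps_double (R := R) n; lra.
  have cc m : cball (st z m).1 (st z m).1.1.
    by rewrite /cball /= (dist_refl dP); have [_ /ltW] := st_good z m.
  have [y yP] : exists y, forall e : R, 0 < e ->
      exists N, forall n, (N <= n)%N -> d (st z n).1.1 y < e.
    case: (dP) => _ _ _ _; apply=> e e0; have [n ne] := eps_small e e0.
    have [m mn] := small n.+1; exists m => i j mi mj.
    have ci := (st_mono z m i mi).1 _ (cc i); have cj := (st_mono z m j mj).1 _ (cc j).
    have := dist_triangle dP (st z m).1.1 (st z i).1.1 (st z j).1.1.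
    rewrite (dist_sym dP (st z i).1.1 (st z m).1.1).
    move: ci cj; rewrite /cball /=; have := eps_double (R := R) n; lra.
  exists y; split=> // m; rewrite /cball /= leNgt; apply/negP => ym.
  have [|N NP] := yP (d (st z m).1.1 y - (st z m).1.2); first lra.
  have := NP (maxn N m) (leq_maxl _ _).
  have := (st_mono z m (maxn N m) (leq_maxr _ _)).1 _ (cc _).
  have := dist_triangle dP (st z (maxn N m)).1.1 (st z m).1.1 y.
  rewrite /cball /=; lra.
move=> z q y qy lim.
(* A shared entry at index [n.+1] puts the points within [eps n], hence the [n.+2]. *)
have near e : 0 < e -> exists M, forall m, (M <= m)%N -> forall q' y',
    agree m q q' -> cauchy_rep d a q' y' -> d y' y < e.
  move=> e0; have [n ne] := eps_small e e0; exists n.+2 => m nm q' y' qq q'y'.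
  have := q'y' n.+1; rewrite -qq //; have := qy n.+1.
  have := dist_triangle dP (a (q n.+1)) y' y.
  rewrite (dist_sym dP y' (a _)); have := eps_double (R := R) n; lra.
split; last first.
  move=> m; rewrite /cball /= leNgt; apply/negP => ym.
  have [|M MP] := near (d (st z m).1.1 y - (st z m).1.2); first lra.
  have [z' [q' [y' [zz qq q'y' [_ /(_ m)]]]]] := lim (maxn M m).
  rewrite -(@st_agree z z'); last by apply: agree_le zz; lia.
  have := MP (maxn M m) (leq_maxl _ _) q' y' qq q'y'.
  have := dist_triangle dP y' (st z m).1.1 y.
  rewrite /cball /=; lra.
apply: contrapT => /existsNP[m zm].
have z0 j : (m <= j)%N -> z j = 0%N.
  by move=> mj; apply: contrapT => zj; apply: zm; exists j.
have [r r0 sep] := childP _ (st_good z m).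
have [|M MP] := near (r / 2); first lra.
(* The child containing the approximating point has an index tending to
   infinity, although these points converge to [y]. *)
have late N : exists t y', [/\ (N <= t)%N, d y' y < r / 2 &
    cball (child (st z m).1 ((st z m).2 + t)%N) y'].
  have [z' [q' [y' [zz qq q'y' [z'inf ball]]]]] := lim (maxn M (m + N)).
  have [j0 mj0 /eqP zj0] := z'inf m.
  have exj : exists j, (m <= j)%N && (z' j != 0%N) by exists j0; rewrite mj0.
  (* Since [z] vanishes from [m] on, the first nonzero entry of [z'] from there lies beyond the
     agreement; until then only the counter grows. *)
  case: (ex_minnP exj) => j /andP[mj zj] jmin.
  have Nj : (maxn M (m + N) <= j)%N.
    rewrite leqNgt; apply/negP => lt_j; move: zj.
    by rewrite -zz // z0.
  have idle : st z' j = ((st z m).1, ((st z m).2 + (j - m))%N).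
    rewrite -{1}(subnKC mj) st_idle.
      by rewrite (@st_agree z z') //; apply: agree_le zz; lia.
    move=> i /andP[mi ij]; apply/eqP; apply: contraT => zi.
    by have := jmin i; rewrite mi zi => /(_ isT); lia.
  exists (j - m)%N, y'; split; first lia.
    exact: MP (leq_maxl _ _) _ _ qq q'y'.
  by have := ball j.+1; rewrite /= (negPf zj) idle.
(* Taking [t2 > t1] gives distinct children, hence points [r] apart that are both closer than
   [r / 2] to [y]. *)
have [t1 [y1 [_ y1y c1]]] := late 0%N; have [t2 [y2 [t12 y2y c2]]] := late t1.+1.
have [_ _ _ /(_ ((st z m).2 + t2)%N y1 y2)] := sep ((st z m).2 + t1)%N.
move=> /(_ ltac:(lia) c1 c2); have := dist_triangle dP y y1 y2.
rewrite (dist_sym dP y y2); lra.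
Qed.

End HurewiczScheme.

(** * Reducing infinite support to nonemptiness *)

Section OvertSigmaCompact.
Set Implicit Arguments. Unset Strict Implicit.
Local Open Scope classical_set_scope.
Context {R : realType} {X : topologicalType} {d : X -> X -> R} {a : nat -> X}.
Context (dP : compatible_complete_metric d).
Context (aP : dense_seq d a).

Lemma jump_overt_sbounded : jump_overt (cauchy_rep d a) -> sbounded (d := d) (a := a) setT.
Proof.
move=> [F [Fcont FP]]; apply: contrapT => /(kernel_nonempty dP aP)[x0 /(closed_graph_relation dP aP)].
move=> [T [Tinf Tclosed]].
(* [H z c s]: the graph of [T] is not yet refuted by [c] entries of [z] and
   the [c] entries [s] of a name. *)
pose H z c s := `[< exists z' q' y, [/\ agree c z z', Defs.prefix q' c = s,
  cauchy_rep d a q' y & T z' y] >].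
(* Output [c] is decided exactly at prefixes of length [c]; the successor marks a defined value. *)
pose p z k : nat := if (unpickle k : option (nat * seq nat)) is Some (c, s) then
  if size s == c then (H z c s).+1 else 0%N else 0%N.
have pE z q c : code_val (p z) q c (H z c (Defs.prefix q c)).
  exists c; split=> [|c' cc']; first by rewrite /p pickleK size_mkseq eqxx.
  by rewrite /p pickleK size_mkseq ltn_eqF.
pose U z y := `[< T z y >].
have pU z : deltaO' (cauchy_rep d a) (p z) (U z).
  move=> q y qy; exists (fun c => H z c (Defs.prefix q c)); split; first by move=> c; exact: pE.
  (* Every row has the same limit, the truth value of [T z y]. *)
  exists (fun=> U z y); split; last first.
    by rewrite /deltaS; case: (U z y); split=> //; [exists 0%N|case].
  move=> n; rewrite /U; case: asboolP => [Tzy|nT].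
    by exists 0%N => i _; rewrite /H asboolT //; exists z, q, y.
  (* By closedness, finitely many entries refute [T z y], after which [H] is 0. *)
  have [m mP] : exists m, forall z' q' y', agree m z z' -> agree m q q' ->
      cauchy_rep d a q' y' -> ~ T z' y'.
    apply: contrapT => nm; apply: nT; apply: Tclosed qy _ => m.
    apply: contrapT => nz; apply: nm; exists m => z' q' y' zz qq q'y' Tz.
    by apply: nz; exists z', q', y'.
  exists m => i mi; rewrite /H asboolF // => -[z' [q' [y' [zz /prefix_agree qq q'y']]]].
  have mc : (m <= cpair n i)%N by apply: leq_trans mi (cpair_ge n i).
  apply: mP q'y'; first exact: agree_le zz.
  exact/(agree_le mc)/agree_sym.
apply: (@inf_support_not_sigma2 (fun z => F (p z))) => [z n|z]; last first.
  have -> : `[< inf_support z >] = IsNonEmpty (U z).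
    apply/asbool_equiv_eq; rewrite -Tinf.
    by split=> -[y yP]; exists y; apply/asboolP.
  exact: FP (pU z).
have [|m mP] := Fcont (p z) _ n; first by exists (U z); exact: pU.
(* [p z k] depends on [z] only through its first [c] entries, with [c] read off from [k]. *)
have [|k _|M MP] := @uniform_bound
  (fun k M => forall z', agree M z z' -> p z' k = p z k) m.
- by move=> k M M' kP MM' z' zz; apply: kP; exact: agree_le zz.
- rewrite /p; case: unpickle => [[c s]|]; last by exists 0%N.
  exists c => z' zz; congr (if _ then _.+1 else _); congr nat_of_bool.
  apply/asbool_equiv_eq; split=> -[z2 [q [y [zz2 qs qy Tz]]]]; exists z2, q, y; split=> //.
    by move=> i ic; rewrite zz ?zz2.
  by move=> i ic; rewrite -zz ?zz2.
- exists M => z' zz; apply: mP; first by exists (U z'); exact: pU.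
  by move=> k km; rewrite (MP k km z').
Qed.

End OvertSigmaCompact.

Theorem theorem36 (R : realType) (X : topologicalType) (d : X -> X -> R)
    (a : nat -> X) :
  compatible_complete_metric d -> dense_seq d a ->
  (jump_overt (cauchy_rep d a) <-> K_sigma X).
Proof.
move=> dP aP; split=> [ov|/(K_sigmaP dP aP) sb].
  by apply/(K_sigmaP dP aP); exact: jump_overt_sbounded.
exact: sbounded_jump_overt sb.
Qed.
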